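(* Let $\vec{E}=(E_x,E_y,E_z):\mathbb{R}^4\to\mathbb{R}^3$ and $\vec{B}=(B_x,B_y,B_z):\mathbb{R}^4\to\mathbb{R}^3$ be differentiable functions of $(t,x,y,z)\in\mathbb{R}^4$. Let $\mathbb{A}_{+}$ be the octonion algebra and $\mathbb{A}_{-}$ the split octonion algebra, both with underlying real vector space with basis $1,e_1,\dots,e_7$ and with multiplication given by the table in the context (upper signs for $\mathbb{A}_{+}$, lower signs for $\mathbb{A}_{-}$). Define the function $$F=E_x e_1+E_y e_2+E_z e_4+B_x e_3+B_y e_6+B_z e_5$$ on $\mathbb{R}^4$ and the operator $\partial=e_1\partial_x+e_2\partial_y+e_4\partial_z+e_7\partial_t$, acting by left multiplication. Then, with the upper sign for $\mathbb{A}_{+}$ and the lower sign for $\mathbb{A}_{-}$, $$\partial F=-\vec{\nabla}\cdot\vec{E}+\Big(\vec{\nabla}\times\vec{E}\mp\frac{\partial\vec{B}}{\partial t}\Big)\cdot\vec{Q}+\Big(-\vec{\nabla}\times\vec{B}+\frac{\partial\vec{E}}{\partial t}\Big)\cdot(e_7\vec{Q})+(\vec{\nabla}\cdot\vec{B})\,e_7,$$ where $\vec{Q}=(e_1,e_2,e_4)$ and $e_7\vec{Q}=(e_7e_1,e_7e_2,e_7e_4)=(e_3,e_6,e_5)$. Consequently, in the split octonions $\mathbb{A}_{-}$, the equation $\partial F=0$ is equivalent to the vacuum Maxwell equations $$\vec{\nabla}\cdot\vec{E}=0,\qquad \vec{\nabla}\times\vec{E}=-\frac{\partial\vec{B}}{\partial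 t},\qquad \vec{\nabla}\cdot\vec{B}=0,\qquad \vec{\nabla}\times\vec{B}=\frac{\partial\vec{E}}{\partial t}.$$
   Context: The algebras $\mathbb{A}_{\pm}$ are the real 8-dimensional (nonassociative) algebras on $\mathrm{Span}_{\mathbb{R}}\{1,e_1,\dots,e_7\}$ with unit $1$, whose bilinear multiplication is given by the following table, where the entry in row $e_i$ and column $e_j$ is the product $e_ie_j$. The upper sign gives the octonions ($\mathbb{A}_+$) and the lower sign gives the split octonions ($\mathbb{A}_-$). $$\begin{array}{c|ccccccc} & e_1 & e_2 & e_3 & e_4 & e_5 & e_6 & e_7\\ \hline e_1 & -1 & e_4 & e_7 & -e_2 & e_6 & -e_5 & -e_3\\ e_2 & -e_4 & -1 & e_5 & e_1 & -e_3 & e_7 & -e_6\\ e_3 & -e_7 & -e_5 & \mp 1 & e_6 & \pm e_2 & \mp e_4 & \pm e_1\\ e_4 & e_2 & -e_1 & -e_6 & -1 & e_7 & e_3 & -e_5\\ e_5 & -e_6 & e_3 & \mp e_2 & -e_7 & \mp 1 & \pm e_1 & \pm e_4\\ e_6 & e_5 & -e_7 & \pm e_4 & -e_3 & \mp e_1 & \mp 1 & \pm e_2\\ e_7 & e_3 & e_6 & \mp e_1 & e_5 & \mp e_4 & \mp e_2 & \mp 1 \end{array}$$ For an algebra-valued function $G=\sum_j G_j u_j$ with real differentiable coefficients $G_j$ in the basis $u_0=1,u_1=e_1,\dots,u_7=e_7$, the operator $\partial$ acts by $$\partial G=\sum_j\big[(\partial_xG_j)\,e_1u_j+(\partial_yG_j)\,e_2u_j+(\partial_zG_j)\,e_4u_j+(\partial_tG_j)\,e_7u_j\big].$$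 For a real vector $\vec{v}=(v_x,v_y,v_z)$ one writes $\vec{v}\cdot\vec{Q}=v_xe_1+v_ye_2+v_ze_4$ and $\vec{v}\cdot(e_7\vec{Q})=v_xe_3+v_ye_6+v_ze_5$. The symbols $\vec{\nabla}\cdot$ and $\vec{\nabla}\times$ denote the usual divergence and curl with respect to $(x,y,z)$. *)

(* Defs.v *)
From HB Require Import structures.
From mathcomp Require Import all_boot all_order all_algebra.
From mathcomp Require Import all_classical all_reals all_analysis.

Set Implicit Arguments.
Unset Strict Implicit.
Unset Printing Implicit Defensive.

Import Order.TTheory GRing.Theory Num.Theory.
Import numFieldNormedType.Exports.

Local Open Scope ring_scope.

Inductive octkind := Octonion | SplitOctonion.

(* The value of the sign "pm": upper for A_+, lower for A_-. The sign "mp" is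
   its opposite. *)
Definition pm (R : realType) (s : octkind) : R :=
  if s is Octonion then 1 else -1.

(* Entries of the multiplication table: Pos k, Neg k, PM k, MP k stand for
   e_k, -e_k, pm e_k, mp e_k, where e_0 = 1. *)
Inductive entry := Pos of nat | Neg of nat | PM of nat | MP of nat.

(* Row i, column j (both counted from 0) is the product e_(i+1) e_(j+1). *)
Definition octtable : seq (seq entry) :=
  [:: [:: Neg 0; Pos 4; Pos 7; Neg 2; Pos 6; Neg 5; Neg 3];
      [:: Neg 4; Neg 0; Pos 5; Pos 1; Neg 3; Pos 7; Neg 6];
      [:: Neg 7; Neg 5; MP 0;  Pos 6; PM 2;  MP 4;  PM 1 ];
      [:: Pos 2; Neg 1; Neg 6; Neg 0; Pos 7; Pos 3; Neg 5];
      [:: Neg 6; Pos 3; MP 2;  Neg 7; MP 0;  PM 1;  PM 4 ];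
      [:: Pos 5; Neg 7; PM 4;  Neg 3; MP 1;  MP 0;  PM 2 ];
      [:: Pos 3; Pos 6; MP 1;  Pos 5; MP 4;  MP 2;  MP 0 ]].

(* Both algebras live on R^8, with basis u 0 = 1 and u k = e_k for 1 <= k <= 7;
   only the product below depends on the kind of algebra. *)
Definition u (R : realType) (k : nat) : 'rV[R]_8 := delta_mx 0 (inord k).

Definition entry_val (R : realType) (s : octkind) (c : entry) : 'rV[R]_8 :=
  match c with
  | Pos k => u R k
  | Neg k => - u R k
  | PM k => pm R s *: u R k
  | MP k => - pm R s *: u R k
  end.

Definition umul (R : realType) (s : octkind) (i j : nat) : 'rV[R]_8 :=
  match i, j with
  | 0%N, _ => u R j
  | _, 0%N => u R i
  | i'.+1, j'.+1 => entry_val R s (nth (Pos 0) (nth [::] octtable i') j')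
  end.

Definition omul (R : realType) (s : octkind) (a b : 'rV[R]_8) : 'rV[R]_8 :=
  \sum_(i < 8) \sum_(j < 8) (a 0 i * b 0 j) *: umul R s i j.

(* Points of R^4 are (t, x, y, z); vectors of R^3 are (v_x, v_y, v_z). *)
Definition ct : 'I_4 := inord 0.
Definition cx : 'I_4 := inord 1.
Definition cy : 'I_4 := inord 2.
Definition cz : 'I_4 := inord 3.

Definition vx (R : realType) (v : 'rV[R]_3) : R := v 0 (inord 0).
Definition vy (R : realType) (v : 'rV[R]_3) : R := v 0 (inord 1).
Definition vz (R : realType) (v : 'rV[R]_3) : R := v 0 (inord 2).

Definition partial (R : realType) (W : normedModType R) (c : 'I_4)
    (f : 'rV[R]_4 -> W) (p : 'rV[R]_4) : W :=
  'D_(delta_mx 0 c) f p.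

Definition div3 (R : realType) (V : 'rV[R]_4 -> 'rV[R]_3) (p : 'rV[R]_4) : R :=
  partial cx (fun q => vx (V q)) p
  + partial cy (fun q => vy (V q)) p
  + partial cz (fun q => vz (V q)) p.

Definition vec3 (R : realType) (a b c : R) : 'rV[R]_3 :=
  \row_(i < 3) nth 0 [:: a; b; c] i.

Definition curl3 (R : realType) (V : 'rV[R]_4 -> 'rV[R]_3) (p : 'rV[R]_4) :
    'rV[R]_3 :=
  vec3
    (partial cy (fun q => vz (V q)) p - partial cz (fun q => vy (V q)) p)
    (partial cz (fun q => vx (V q)) p - partial cx (fun q => vz (V q)) p)
    (partial cx (fun q => vy (V q)) p - partial cy (fun q => vx (V q)) p).

(* The operator e_1 d/dx + e_2 d/dy + e_4 d/dz + e_7 d/dt. *)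
Definition odiff (R : realType) (s : octkind) (G : 'rV[R]_4 -> 'rV[R]_8)
    (p : 'rV[R]_4) : 'rV[R]_8 :=
  \sum_(j < 8)
    (partial cx (fun q => G q 0 j) p *: omul s (u R 1) (u R j)
     + partial cy (fun q => G q 0 j) p *: omul s (u R 2) (u R j)
     + partial cz (fun q => G q 0 j) p *: omul s (u R 4) (u R j)
     + partial ct (fun q => G q 0 j) p *: omul s (u R 7) (u R j)).

(* v . Q with Q = (e_1, e_2, e_4), and v . (e_7 Q) with
   e_7 Q = (e_3, e_6, e_5). *)
Definition dotQ (R : realType) (v : 'rV[R]_3) : 'rV[R]_8 :=
  vx v *: u R 1 + vy v *: u R 2 + vz v *: u R 4.

Definition dote7Q (R : realType) (v : 'rV[R]_3) : 'rV[R]_8 :=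
  vx v *: u R 3 + vy v *: u R 6 + vz v *: u R 5.

Definition emF (R : realType) (E B : 'rV[R]_4 -> 'rV[R]_3) (p : 'rV[R]_4) :
    'rV[R]_8 :=
  vx (E p) *: u R 1 + vy (E p) *: u R 2 + vz (E p) *: u R 4
  + vx (B p) *: u R 3 + vy (B p) *: u R 6 + vz (B p) *: u R 5.

(* Main.v *)
Require Import Defs.
From mathcomp Require Import all_boot all_order all_algebra.
From mathcomp Require Import all_classical all_reals all_analysis.
From mathcomp Require Import ring.
Import Order.TTheory GRing.Theory Num.Theory.
Import numFieldNormedType.Exports.
Local Open Scope ring_scope.

(** Both sides are linear in the first partial derivatives of the components of [E] and [B], so it
    is enough to read the products e_i e_j with i in {1,2,4,7} off the table. The squares e_i^2 = -1
    for i = 1,2,4 give -div E, and the cyclic rules e_1 e_2 = e_4, e_2 e_4 = e_1, e_4 e_1 = e_2 give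
    curl E. The products of Q with e_7 Q give -curl B and, from e_1 e_3 = e_2 e_6 = e_4 e_5 = e_7,
    div B. Since e_7 Q = (e_3, e_6, e_5), time derivatives of E land on e_7 Q. The algebras differ
    only where e_7 multiplies e_3, e_6, e_5, whence the sign of the time derivative of B.
    [odiff_emF] checks this coordinate by coordinate.

    For Maxwell, [emform_eq0] separates the four blocks, and the split sign -1 yields Faraday's
    law. *)

Lemma coord_u (R : realType) (k : nat) (j : 'I_8) :
  (k < 8)%N -> u R k 0 j = (j == k :> nat)%:R.
Proof. by move=> k8; rewrite /u mxE eqxx /= -val_eqE /= inordK. Qed.

Lemma omul_u (R : realType) (s : octkind) (i j : nat) :
  (i < 8)%N -> (j < 8)%N -> omul s (u R i) (u R j) = umul R s i j.
Proof.
move=> i8 j8; rewrite /omul (bigD1 (Ordinal i8)) //= (bigD1 (Ordinal j8)) //=.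
rewrite !coord_u // !eqxx mulr1 scale1r.
rewrite !big1 ?addr0 // => [a|a] ne; last first.
  by rewrite coord_u // -(inj_eq val_inj) /= in ne *; rewrite (negbTE ne) mulr0 scale0r.
apply: big1 => b _.
by rewrite -(inj_eq val_inj) /= in ne; rewrite coord_u // (negbTE ne) mul0r scale0r.
Qed.

(** The list follows the basis order, so the components interleave: [E] sits on e_1, e_2, e_4 and
    [B] on e_3, e_6, e_5. *)
Lemma emF_coord (R : realType) (E B : 'rV[R]_4 -> 'rV[R]_3) q (j : 'I_8) :
  emF E B q 0 j =
  nth 0 [:: 0; vx (E q); vy (E q); vx (B q); vz (E q); vz (B q); vy (B q); 0] j.
Proof.
case: j => [] [|[|[|[|[|[|[|[|//]]]]]]]] ij.
all: rewrite /emF !mxE -!val_eqE /= !inordK //=; ring.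
Qed.

(** Time derivatives in the final formula are those of vector-valued maps, whereas [odiff]
    differentiates coordinates; differentiability reconciles the two. *)
Lemma partial_coord (R : realType) (n : nat) (V : 'rV[R]_4 -> 'rV[R]_n)
    (c : 'I_4) (p : 'rV[R]_4) (i : 'I_n) :
  differentiable V p -> partial c V p 0 i = partial c (fun q => V q 0 i) p.
Proof.
by move=> dV; rewrite /partial derive_mx ?mxE //; apply: diff_derivable.
Qed.

Lemma vec3_ext (R : realType) (v w : 'rV[R]_3) :
  vx v = vx w -> vy v = vy w -> vz v = vz w -> v = w.
Proof.
move=> ex ey ez; apply/rowP => -[] [|[|[|//]]] i3.
- by move: ex; rewrite /vx; congr (v 0 _ = w 0 _); apply: val_inj; rewrite /= inordK.
- by move: ey; rewrite /vy; congr (v 0 _ = w 0 _); apply: val_inj; rewrite /= inordK.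
- by move: ez; rewrite /vz; congr (v 0 _ = w 0 _); apply: val_inj; rewrite /= inordK.
Qed.

Lemma vec3K (R : realType) (a b c : R) :
  (vx (vec3 a b c) = a) * (vy (vec3 a b c) = b) * (vz (vec3 a b c) = c).
Proof. by rewrite /vx /vy /vz /vec3 !mxE !inordK. Qed.

Lemma vec3_subZ (R : realType) (a : R) (v w : 'rV[R]_3) :
  (vx (v - a *: w) = vx v - a * vx w) * (vy (v - a *: w) = vy v - a * vy w)
  * (vz (v - a *: w) = vz v - a * vz w).
Proof. by rewrite /vx /vy /vz !mxE. Qed.

Lemma vec3_addN (R : realType) (v w : 'rV[R]_3) :
  (vx (- v + w) = - vx v + vx w) * (vy (- v + w) = - vy v + vy w)
  * (vz (- v + w) = - vz v + vz w).
Proof. by rewrite /vx /vy /vz !mxE. Qed.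

Lemma vec3_partial (R : realType) (V : 'rV[R]_4 -> 'rV[R]_3) (c : 'I_4)
    (p : 'rV[R]_4) :
  differentiable V p ->
  (vx (partial c V p) = partial c (fun q => vx (V q)) p) *
  (vy (partial c V p) = partial c (fun q => vy (V q)) p) *
  (vz (partial c V p) = partial c (fun q => vz (V q)) p).
Proof. by move=> dV; rewrite /vx /vy /vz !partial_coord. Qed.

Lemma emform_coord (R : realType) (a b : R) (v w : 'rV[R]_3) (j : 'I_8) :
  (a *: u R 0 + dotQ v + dote7Q w + b *: u R 7) 0 j =
  nth 0 [:: a; vx v; vy v; vx w; vz v; vz w; vy w; b] j.
Proof.
case: j => [] [|[|[|[|[|[|[|[|//]]]]]]]] ij.
all: rewrite /dotQ /dote7Q !mxE -!val_eqE /= !inordK //=; ring.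
Qed.

(** The four blocks occupy disjoint sets of coordinates that together exhaust the basis. *)
Lemma emform_eq0 (R : realType) (a b : R) (v w : 'rV[R]_3) :
  a *: u R 0 + dotQ v + dote7Q w + b *: u R 7 = 0 <->
  [/\ a = 0, v = 0, w = 0 & b = 0].
Proof.
split=> [z|[-> -> -> ->]].
  have h (k : nat) (k8 : (k < 8)%N) :
      nth 0 [:: a; vx v; vy v; vx w; vz v; vz w; vy w; b] k = 0.
    by rewrite -(emform_coord R a b v w (Ordinal k8)) z mxE.
  split; [exact: (h 0 isT) | apply: vec3_ext; rewrite [RHS]mxE
    | apply: vec3_ext; rewrite [RHS]mxE | exact: (h 7 isT)].
  - exact: (h 1 isT).
  - exact: (h 2 isT).
  - exact: (h 4 isT).
  - exact: (h 3 isT).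
  - exact: (h 6 isT).
  - exact: (h 5 isT).
by rewrite /dotQ /dote7Q /vx /vy /vz !mxE !scale0r !addr0.
Qed.

Lemma partial0 (R : realType) (c : 'I_4) (p : 'rV[R]_4) :
  partial c (fun=> 0 : R) p = 0.
Proof. exact: derive_cst. Qed.

Lemma odiff_emF (R : realType) (E B : 'rV[R]_4 -> 'rV[R]_3) (s : octkind)
    (p : 'rV[R]_4) :
  differentiable E p -> differentiable B p ->
  odiff s (emF E B) p
  = - div3 E p *: u R 0
    + dotQ (curl3 E p - pm R s *: partial ct B p)
    + dote7Q (- curl3 B p + partial ct E p)
    + div3 B p *: u R 7.
Proof.
move=> dE dB; apply/rowP => i; rewrite emform_coord.
have -> : odiff s (emF E B) p = \sum_(j < 8)
   (let d c := partial c (fun q => nth 0 [:: 0; vx (E q); vy (E q); vx (B q);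
                            vz (E q); vz (B q); vy (B q); 0] j) p in
    d cx *: umul R s 1 j + d cy *: umul R s 2 j
    + d cz *: umul R s 4 j + d ct *: umul R s 7 j).
  apply: eq_bigr => j _; rewrite !omul_u //=.
  by under eq_fun do rewrite emF_coord.
rewrite !big_ord_recl big_ord0 /= !partial0 !scale0r.
rewrite !vec3_subZ !vec3_addN !vec3K /div3.
rewrite !vec3_partial //.
(* Each partial derivative becomes an arbitrary scalar, leaving a polynomial identity in every
   coordinate. *)
do ! (set d := (partial _ _ _); move: d).
case: i => [] [|[|[|[|[|[|[|[|//]]]]]]]] ij; move=> /= *.
all: rewrite !mxE -!val_eqE /= !inordK //=; ring.
Qed.

Theorem mainTheorem1 (R : realType) (E B : 'rV[R]_4 -> 'rV[R]_3)
    (dE : forall p : 'rV[R]_4, differentiable E p)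
    (dB : forall p : 'rV[R]_4, differentiable B p) :
  (forall s : octkind,
     [/\ omul s (u R 7) (u R 1) = u R 3,
         omul s (u R 7) (u R 2) = u R 6,
         omul s (u R 7) (u R 4) = u R 5
       & forall p : 'rV[R]_4,
           odiff s (emF E B) p
           = - div3 E p *: u R 0
             + dotQ (curl3 E p - pm R s *: partial ct B p)
             + dote7Q (- curl3 B p + partial ct E p)
             + div3 B p *: u R 7])
  /\ ((forall p : 'rV[R]_4, odiff SplitOctonion (emF E B) p = 0)
      <-> (forall p : 'rV[R]_4,
             [/\ div3 E p = 0,
                 curl3 E p = - partial ct B p,
                 div3 B p = 0
               & curl3 B p = partial ct E p])).
Proof.
split=> [s|].
  split=> [|||p]; rewrite ?omul_u //; exact: odiff_emF.
split=> H p; last first.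
  rewrite odiff_emF //; apply/emform_eq0.
  have [-> -> -> ->] := H p.
  by rewrite /pm scaleN1r opprK oppr0 !addNr.
have := H p; rewrite odiff_emF // => /emform_eq0[/eqP].
(* With [pm] equal to -1, the Q block is the curl of [E] plus the time derivative of [B]. *)
rewrite oppr_eq0 /pm scaleN1r opprK => /eqP dE0 cE cB dB0; split=> //.
  by apply/eqP; rewrite -addr_eq0; exact/eqP.
by apply/esym/eqP; rewrite -subr_eq0 addrC; exact/eqP.
Qed.
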